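(* Let $S_1\subseteq\mathbb{R}^2$ be the Warsaw sine curve, i.e. the closure in $\mathbb{R}^2$ of the set $\{(x,\sin(\frac1x)):x\in(0,\frac{2}{3\pi}]\}$. There exist exactly four distinct ultrafilter orders on the chainable continuum $S_1$.
   Context: A continuum is a compact connected metrizable space; fix a metric generating its topology. A chain in $X$ is a finite sequence of open sets $d_1,\dots,d_k$ (its links) with $d_i\cap d_j\neq\varnothing\iff|i-j|\le 1$; its mesh is the maximum of the diameters of its links. $X$ is chainable if for every $\varepsilon>0$ it is covered by a chain of mesh less than $\varepsilon$. $\mathbb{N}=\{1,2,3,\dots\}$. Let $\mathcal{D}=\{D_n\}_{n\in\mathbb{N}}$ be a sequence of chains $D_n=\{d_{1,n},\dots,d_{k_n,n}\}$, each covering $X$, with $\mathrm{mesh}(D_n)\to 0$, and let $\mathcal{U}$ be a non-principal ultrafilter on $\mathbb{N}$. Write $x\leq_{D_n}y$ iff there exist $i\le j\le k_n$ with $x\in d_{i,n}$ and $y\in d_{j,n}$, and $x\leq_{\mathcal{U}}^{\mathcal{D}}y$ iff $\{n\in\mathbb{N}: x\leq_{D_n}y\}\in\mathcal{U}$. This is a linear order on $X$. An ultrafilter order on $X$ is any order of the form $\leq_{\mathcal{U}}^{\mathcal{D}}$ for some such $\mathcal{D}$ and $\mathcal{U}$ (both are allowed to vary); two ultrafilter orders are distinct if they are different as relations on $X$. *)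

(* Defs.v *)
From HB Require Import structures.
From mathcomp Require Import all_boot all_order all_algebra.
From mathcomp Require Import all_classical all_reals all_analysis.

Set Implicit Arguments.
Unset Strict Implicit.
Unset Printing Implicit Defensive.

Import Order.TTheory GRing.Theory Num.Theory.
Import numFieldNormedType.Exports.

Local Open Scope classical_set_scope.
Local Open Scope ring_scope.

Section Metrics.
Context {R : realType} {X : topologicalType}.
Implicit Types (dist : X -> X -> R).

Definition is_metric dist : Prop :=
  [/\ forall x y, 0 <= dist x y,
      forall x y, dist x y = 0 <-> x = y,
      forall x y, dist x y = dist y x &
      forall x y z, dist x z <= dist x y + dist y z].

Definition compatible_metric dist : Prop :=
  is_metric dist /\
  forall (x : X) (A : set X),
    nbhs x A <-> exists2 e : R, 0 < e & [set y | dist x y < e] `<=` A.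

(* Extended-real valued: a set may be unbounded; the diameter of set0 is -oo. *)
Definition diameter dist (A : set X) : \bar R :=
  ereal_sup [set (dist p.1 p.2)%:E | p in A `*` A].

Definition mesh dist (D : seq (set X)) : \bar R :=
  (\big[maxe/-oo]_(A <- D) diameter dist A)%E.

End Metrics.

Definition continuum (R : realType) (X : topologicalType) : Prop :=
  [/\ compact [set: X], connected [set: X] &
      exists dist : X -> X -> R, compatible_metric dist].

Section Chains.
Context {X : topologicalType}.
Implicit Types (D : seq (set X)).

(* The links d_1, ..., d_k are nth set0 D 0, ..., nth set0 D k.-1.  The case
   i = j of the intersection condition says that links are nonempty. *)
Definition is_chain D : Prop :=
  (forall i, (i < size D)%N -> open (nth set0 D i)) /\
  (forall i j, (i < size D)%N -> (j < size D)%N ->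
     (nth set0 D i `&` nth set0 D j !=set0) <-> (`|i - j| <= 1)%N).

Definition covers D : Prop :=
  forall x : X, exists2 i, (i < size D)%N & nth set0 D i x.

Definition chain_le D : X -> X -> Prop := fun x y =>
  exists i j, [/\ (i <= j)%N, (j < size D)%N, nth set0 D i x & nth set0 D j y].

Definition nonprincipal_ultrafilter (U : set_system nat) : Prop :=
  UltraFilter U /\ forall n, U <> principal_filter n.

Definition ultrafilter_le (D : nat -> seq (set X)) (U : set_system nat) :
    X -> X -> Prop :=
  fun x y => U [set n | chain_le (D n) x y].

End Chains.

Definition chainable (R : realType) (X : topologicalType)
    (dist : X -> X -> R) : Prop :=
  forall e : R, 0 < e ->
    exists D : seq (set X), [/\ is_chain D, covers D & (mesh dist D < e%:E)%E].

Definition ultrafilter_orders (R : realType) (X : topologicalType)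
    (dist : X -> X -> R) : set (X -> X -> Prop) :=
  [set r | exists (D : nat -> seq (set X)) (U : set_system nat),
     [/\ forall n, is_chain (D n) /\ covers (D n),
         mesh dist (D n) @[n --> \oo] --> 0%E,
         nonprincipal_ultrafilter U &
         r = ultrafilter_le D U]].

(* Used as a type, S1 R is a subtype of R * R with the induced topology. *)
Definition S1 (R : realType) : set (R * R) :=
  closure [set (x, sin (1 / x)) | x in [set x : R | 0 < x <= 2 / (3 * pi)]].

Arguments S1 R : clear implicits.

(* Main.v *)
Require Import Defs.
From HB Require Import structures.
From mathcomp Require Import all_boot all_order all_algebra.
From mathcomp Require Import all_classical all_reals all_analysis.
From mathcomp Require Import lra zify.

Import Order.TTheory GRing.Theory Num.Theory.
Import numFieldNormedType.Exports.

Local Open Scope classical_set_scope.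
Local Open Scope ring_scope.

Set Implicit Arguments.
Unset Strict Implicit.
Unset Printing Implicit Defensive.

(** The Warsaw sine curve is the vertical bar [L = {0} x [-1, 1]] together with
    a ray, the graph of [sin (1 / x)], that winds down onto it.

    Upper bound.  Let [C] be closed and connected and [p] a point outside [C].
    Once the mesh of a chain is smaller than the distance from [p] to [C], no
    link contains [p] and meets [C], so the links meeting [C] all lie on the
    same side of those containing [p]: a chain cannot put [p] between two points
    of [C] ([chain_le_side]).  This passes to every ultrafilter order
    ([ultrafilter_le_side]).  Together with totality and antisymmetry it leaves
    two binary choices.  Taking for [C] the part of the curve left of a vertical
    line, or a subarc of the ray, shows that all comparisons between points with
    different abscissas agree with the comparison of the bar with the endpoint
    of the ray; taking for [C] a subsegment of [L] shows that all comparisons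
    inside [L] agree with the comparison of its two ends
    ([warsaw_le_classification]).  So every ultrafilter order is one of the four
    relations [warsaw_le o u].

    Existence.  Cut the curve at a point [(a, s)] of the ray where
    [s = sin (1 / a)] is [1] or [-1].  The map [fold] sends the piece
    left of the cut to [s * y] and unrolls the rest of the ray beyond [1]; the
    two formulas agree at the cut because it is a crest.  Its fibres are
    singletons or horizontal slices of the left piece, so they are small when
    [a] is ([thin_fold]).  Pulling back overlapping short intervals along such a
    map gives a chain of small mesh whose order follows the map
    ([small_fibers_chain]).  The sign [s] decides the direction of [L] relative
    to the ray, and replacing [fold] by its opposite reverses everything, which
    realizes all four orders ([warsaw_chain]).

    An arbitrary compatible metric is handled by compactness alone: a continuous
    function on pairs that is positive on far apart pairs is bounded below there
    ([compact_modulus]). *)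

(** * The order of a single chain *)

Section ChainOrder.
Context {X : topologicalType}.
Implicit Types (D : seq (set X)) (C : set X).

Lemma mem_link_size D k x : nth set0 D k x -> (k < size D)%N.
Proof. by case: ltnP => // kD; rewrite nth_default. Qed.

Lemma chain_le_total D x y : covers D -> chain_le D x y \/ chain_le D y x.
Proof.
move=> cov; have [i iD Di] := cov x; have [j jD Dj] := cov y.
by case: (leqP i j) => ij; [left; exists i, j|right; exists j, i; rewrite ltnW].
Qed.

(** The indices of the links containing a given point differ by at most one, so
    opposite comparisons of [x] and [y] force a common link. *)
Lemma chain_le_antisym D x y : is_chain D ->
  chain_le D x y -> chain_le D y x -> exists k, nth set0 D k x /\ nth set0 D k y.
Proof.
move=> [_ cD] [i [j [ij jD Dix Djy]]] [k [l [kl lD Dky Dlx]]].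
have il : (`|i - l| <= 1)%N.
  by apply/(cD i l _ _); [exact: leq_ltn_trans jD | | exists x].
have jk : (`|j - k| <= 1)%N.
  by apply/(cD j k _ _); [| exact: leq_ltn_trans lD | exists y].
have [eij|nij] := eqVneq i j; first by exists i; split => //; rewrite eij.
have [ekl|nkl] := eqVneq k l; first by exists k; split => //; rewrite ekl.
by exists i; split => //; have -> : i = k by move: il jk ij kl nij nkl; lia.
Qed.

(** The link containing [p] misses [C], and links before it are disjoint from
    links after it. So the links before it trace a set on [C] that is both open
    and closed in [C], hence all of [C] as soon as [c] is there. *)
Lemma chain_le_side D C p c c' : is_chain D -> covers D -> connected C ->
  (forall k, nth set0 D k p -> C `&` nth set0 D k = set0) ->
  C c -> C c' -> chain_le D c p -> chain_le D c' p.
Proof.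
move=> [oD cD] cov connC disj Cc Cc' [i [j [ij jD Dic Djp]]].
(* [U] and [V] are disjoint open sets covering [C], since the link [j] misses
   it. *)
pose U := \bigcup_(k in [set k | (k < j)%N]) nth set0 D k.
pose V := \bigcup_(k in [set k | (j < k)%N]) nth set0 D k.
have onth k : open (nth set0 D k).
  by case: (ltnP k (size D)) => kD; [exact: oD|rewrite nth_default//; exact: open0].
have CnV : C `&` U = C `&` ~` V.
  apply/seteqP; split=> [z [Cz [k kj Dkz]]|z [Cz nVz]]; split => //.
    move=> [l jl Dlz].
    have /cD : (nth set0 D k `&` nth set0 D l) !=set0 by exists z.
    by move=> /(_ (mem_link_size Dkz) (mem_link_size Dlz)); move: kj jl => /=; lia.
  have [k kD Dkz] := cov z; exists k => //=.
  case: (ltngtP k j) => // [jk|kj]; first by exfalso; apply: nVz; exists k.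
  by have := disj _ Djp; rewrite -kj => /seteqP[/(_ z)] [].
have CUC : C `&` U = C.
  apply: connC.
  - exists c; split => //; exists i => //=.
    rewrite ltn_neqAle ij andbT; apply/eqP => eij.
    by have := disj _ Djp; rewrite -eij => /seteqP[/(_ c)] [].
  - by exists U => //; apply: bigcup_open.
  - by exists (~` V) => //; apply: open_closedC; apply: bigcup_open.
move: Cc'; rewrite -CUC => -[Cc' [k /= kj Dkc']].
by exists k, j; split => //; exact: ltnW.
Qed.

End ChainOrder.

(** * Mesh and distances *)

Section Mesh.
Context {R : realType} {X : topologicalType} (dist : X -> X -> R).
Implicit Types (D : seq (set X)) (C : set X).

Lemma dist_lt_mesh D k (e : R) x y : (mesh dist D < e%:E)%E ->
  nth set0 D k x -> nth set0 D k y -> dist x y < e.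
Proof.
move=> De Dx Dy; rewrite -lte_fin; apply: le_lt_trans De.
have Dk : nth set0 D k \in D by apply: mem_nth; exact: mem_link_size Dx.
have : ((dist x y)%:E <= diameter dist (nth set0 D k))%E.
  by apply: ereal_sup_ubound; exists (x, y).
by move=> /le_trans; apply; exact: (Order.TotalTheory.le_bigmax_seq _ _ _ _ Dk).
Qed.

Lemma mesh_le D (e : R) :
  (forall k x y, nth set0 D k x -> nth set0 D k y -> dist x y <= e) ->
  (mesh dist D <= e%:E)%E.
Proof.
move=> De; rewrite /mesh big_seq; elim/big_rec: _ => [|A m AD mD].
  exact: leNye.
rewrite ge_max mD andbT; have [k _ <-] := nthP set0 AD.
apply: ge_ereal_sup => _ [[x y] [/= Dx Dy] <-].
by rewrite lee_fin; exact: De Dx Dy.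
Qed.

Hypothesis dc : compatible_metric dist.

(** Bounds the mesh below which no link contains [p] and meets [C]. *)
Lemma closed_dist_gt0 C p : closed C -> ~ C p ->
  exists2 e : R, 0 < e & forall c, C c -> e <= dist p c.
Proof.
move=> cC nCp; have [_ nd] := dc.
have : nbhs p (~` C) by apply: open_nbhs_nbhs; split => //; exact: closed_openC.
move=> /nd [e e0 eC]; exists e => // c Cc; rewrite leNgt; apply/negP => pc.
exact: (eC c).
Qed.

End Mesh.

(** * Orders defined by an ultrafilter *)

(** If a singleton [set n] were in the ultrafilter, the ultrafilter would be
    principal at [n]; so it contains every complement of a singleton, hence
    every tail. *)
Lemma ultra_cofinite (U : set_system nat) :
  nonprincipal_ultrafilter U -> \oo `<=` U.
Proof.
move=> [UU nU] A [N _ NA]; have UP := @ultra_proper _ _ UU.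
have U1 n : U (~` [set n]).
  have [Un|//] := in_ultra_setVsetC [set n] UU.
  case: (nU n); apply: esym; apply: (@max_filter _ _ UU).
    exact: principal_filter_proper.
  move=> B UB m ->.
  by apply: contrapT => nBn; apply: (@filter_not_empty _ U);
    apply: filterS (filterI Un UB) => k [-> Bn]; exact: nBn.
have UN : U [set n | (N <= n)%N].
  elim: N {NA} => [|N IH]; first exact: filterE.
  apply: filterS (filterI IH (U1 N)) => n [/= Nn nN].
  by rewrite ltn_neqAle Nn andbT; apply/eqP => /esym.
exact: filterS UN.
Qed.

Section UltrafilterOrder.
Context {R : realType} {X : topologicalType} (dist : X -> X -> R).
Hypothesis dc : compatible_metric dist.
Variables (D : nat -> seq (set X)) (U : set_system nat).
Hypothesis D_chain : forall n, is_chain (D n) /\ covers (D n).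
Hypothesis D_mesh : mesh dist (D n) @[n --> \oo] --> 0%E.
Hypothesis U_np : nonprincipal_ultrafilter U.

Let U_ultra : UltraFilter U := U_np.1.
Let U_proper : ProperFilter U := @ultra_proper _ _ U_ultra.
#[local] Existing Instance U_proper.

Lemma ultra_mesh_lt (e : R) : 0 < e ->
  U [set n | (mesh dist (D n) < e%:E)%E].
Proof.
move=> e0; apply: (ultra_cofinite U_np).
have /D_mesh// : nbhs 0%E [set x : \bar R | (x < e%:E)%E].
by apply: open_nbhs_nbhs; split; [exact: open_ereal_lt_ereal|rewrite /= lte_fin].
Qed.

Lemma ultrafilter_le_total x y :
  ultrafilter_le D U x y \/ ultrafilter_le D U y x.
Proof.
have [|nxy] := in_ultra_setVsetC [set n | chain_le (D n) x y] U_ultra.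
  by left.
right; apply: filterS nxy => n /= nxy.
by have [] := chain_le_total x y (D_chain n).2.
Qed.

(** Two distinct points share no link once the mesh is below their distance. *)
Lemma ultrafilter_le_antisym x y :
  ultrafilter_le D U x y -> ultrafilter_le D U y x -> x = y.
Proof.
move=> xy yx; have [[d0 dE _ _] _] := dc; apply/dE/eqP.
rewrite eq_le d0 andbT leNgt; apply/negP => dxy.
have [] // := @filter_ex _ U _ _ (filterI (filterI xy yx) (ultra_mesh_lt dxy)).
move=> n [[/= nxy nyx]] mn.
have [k [kx ky]] := chain_le_antisym (D_chain n).1 nxy nyx.
by have := dist_lt_mesh mn kx ky; rewrite ltxx.
Qed.

Lemma ultrafilter_le_side C p c c' : closed C -> connected C -> ~ C p ->
  C c -> C c' -> ultrafilter_le D U c p -> ultrafilter_le D U c' p.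
Proof.
move=> clC connC nCp Cc Cc' cp; have [e e0 eC] := closed_dist_gt0 dc clC nCp.
apply: filterS (filterI cp (ultra_mesh_lt e0)) => n [/= ncp mn].
have [chD covD] := D_chain n.
apply: (chain_le_side chD covD connC _ Cc Cc' ncp) => k kp.
apply/seteqP; split => // z [Cz kz].
by have := dist_lt_mesh mn kp kz; rewrite ltNge eC.
Qed.

End UltrafilterOrder.

(** * Chains of level sets *)

Section LevelChain.
Context {R : realType} {X : topologicalType}.

(** When [g] is onto [[0, N]], the preimages of the open intervals of radius [1]
    around the integers [0, ..., N] form a chain: consecutive intervals overlap
    around the half integer between them, the others are disjoint. *)
Definition level_chain (g : X -> R) N : seq (set X) :=
  mkseq (fun i => [set x | `|g x - i%:R| < 1]) N.+1.

Lemma level_chainE (g : X -> R) N i : (i < N.+1)%N ->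
  nth set0 (level_chain g N) i = [set x | `|g x - i%:R| < 1].
Proof. exact: nth_mkseq. Qed.

Lemma connected_IVT (g : X -> R) p q v : continuous g -> connected [set: X] ->
  g p <= v <= g q -> exists x, g x = v.
Proof.
move=> cg cX pvq.
have /connected_intervalP iX : connected (g @` [set: X]).
  by apply: connected_continuous_connected => //; exact: continuous_subspaceT.
by have [||x _ <-] := iX (g p) (g q) _ _ v pvq; [exists p|exists q|exists x].
Qed.

Variables (g : X -> R) (N : nat).
Hypothesis (g_cont : continuous g) (X_conn : connected [set: X]).
Hypothesis g_bound : forall x, 0 <= g x <= N%:R.
Variables (p q : X).
Hypothesis (g_p : g p = 0) (g_q : g q = N%:R).

Lemma level_chain_chain : is_chain (level_chain g N).
Proof.
split=> [i|i j]; rewrite size_mkseq => iN.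
  rewrite level_chainE//.
  have -> : [set x | `|g x - i%:R| < 1] = g @^-1` ball (i%:R : R) 1.
    by apply/seteqP; split=> x /=; rewrite /ball/= distrC.
  by apply: open_comp; [move=> x _; exact: g_cont|exact: ball_open].
move=> jN; rewrite !level_chainE//; split=> [[x [/= xi xj]]|ij].
  have : `|i%:R - j%:R| < 2 :> R.
    by move: xi xj; rewrite !ltr_norml; lra.
  rewrite -[i%:R]/(i%:~R) -[j%:R]/(j%:~R) -intrB -intr_norm -[2]/(2%:~R) ltr_int.
  by lia.
wlog : i j iN jN ij / (i <= j)%N.
  move=> H; case: (leqP i j) => [|/ltnW] h; first exact: H.
  by rewrite setIC; apply: H => //; rewrite distnC.
move=> lij; have [eij|eij] := eqVneq i j.
  have [x gx] : exists x, g x = i%:R.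
    apply: (@connected_IVT g p q) => //.
    by rewrite g_p g_q ler0n ler_nat -ltnS.
  by exists x; split => /=; rewrite gx -?eij subrr normr0.
have ji : j = i.+1 by move: ij lij eij; lia.
have [x gx] : exists x, g x = i%:R + 2^-1.
  apply: (@connected_IVT g p q) => //.
  have : i.+1%:R <= N%:R :> R by rewrite ler_nat -ltnS -ji.
  have : 0 <= i%:R :> R by [].
  by rewrite g_p g_q -natr1; lra.
by exists x; split; rewrite /= gx ?ji -?(natr1 i) ltr_norml; lra.
Qed.

(** The rounded-down value of [g x] indexes a link containing [x]; being
    monotone in [g x], it also yields the order of the chain. *)
Lemma level_chain_floor x :
  exists i, [/\ (i < N.+1)%N, i%:R <= g x < i.+1%:R &
                nth set0 (level_chain g N) i x].
Proof.
have /andP[g0 gN] := g_bound x; pose i := Num.truncn (g x).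
have /andP[h1 h2] : i%:R <= g x < i.+1%:R by exact: truncn_itv.
have iN : (i < N.+1)%N by rewrite ltnS -(ler_nat R); exact: le_trans h1 gN.
exists i; split => //; first by rewrite h1 h2.
by rewrite level_chainE//= ltr_norml; move: h1 h2; rewrite -natr1; lra.
Qed.

Lemma level_chain_covers : covers (level_chain g N).
Proof.
move=> x; have [i [iN _ ix]] := level_chain_floor x.
by exists i => //; rewrite size_mkseq.
Qed.

Lemma level_chain_le x y : g x <= g y -> chain_le (level_chain g N) x y.
Proof.
move=> xy; have [i [iN /andP[i1 i2] ix]] := level_chain_floor x.
have [j [jN /andP[j1 j2] jy]] := level_chain_floor y.
exists i, j; split => //; last by rewrite size_mkseq.
by rewrite -ltnS -(ltr_nat R); apply: le_lt_trans j2; exact: le_trans xy.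
Qed.

End LevelChain.

(** * Chains from maps with small fibres *)

Section CompactMetric.
Context {R : realType} {X : topologicalType} (dist : X -> X -> R).
Hypothesis dc : compatible_metric dist.
Hypothesis X_compact : compact [set: X].

Lemma dist_far_closed (e : R) : closed [set p : X * X | e <= dist p.1 p.2].
Proof.
have [[_ _ dC dT] nd] := dc.
suff : open [set p : X * X | dist p.1 p.2 < e].
  move=> /open_closedC; congr closed.
  by apply/seteqP; split=> p /=; rewrite leNgt => /negP.
rewrite openE => -[x y] /= xye; pose r := (e - dist x y) / 2.
have r0 : 0 < r by rewrite divr_gt0// subr_gt0.
exists ([set z | dist x z < r], [set z | dist y z < r]).
  by split; apply/nd; exists r.
move=> [z w] /= [xz yw]; have := dT z x w; have := dT x y w.
by rewrite (dC z x); move: xz yw; rewrite /r; lra.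
Qed.

(** On the compact set of pairs at distance at least [e], [h] attains its
    minimum, which is positive. *)
Lemma compact_modulus (h : X * X -> R) (e : R) : continuous h ->
  (forall x y, e <= dist x y -> 0 < h (x, y)) ->
  exists2 d : R, 0 < d & forall x y, h (x, y) < d -> dist x y < e.
Proof.
move=> ch h0; pose A := [set p : X * X | e <= dist p.1 p.2].
have [A0|/set0P An] := eqVneq A set0.
  exists 1 => // x y _; rewrite ltNge; apply/negP => exy.
  by have : A (x, y) by []; rewrite A0.
have cA : compact A.
  apply: (@subclosed_compact _ _ ([set: X] `*` [set: X])) => //.
    exact: dist_far_closed.
  exact: compact_setX.
have [|[a b] /set_mem Aab ab_min] := compact_EVT_min An cA (f := h).
  exact: continuous_subspaceT.
exists (h (a, b)); first exact: h0.
move=> x y; rewrite ltNge [in X in _ -> X]ltNge; apply: contra => exy.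
by apply: ab_min; exact/mem_set.
Qed.

Hypothesis X_connected : connected [set: X].

(** By [compact_modulus], points whose [f]-values differ by less than some [d]
    are [e]-close. Rescale [f] to a map onto [[0, N]]: on a link of its level
    chain the rescaled map varies by less than [2], so [f] varies by less than
    [d] once [N] is large. *)
Lemma small_fibers_chain (f : X -> R) (p q : X) (e : R) : continuous f ->
  (forall x, f p <= f x <= f q) -> f p < f q ->
  (forall x y, f x = f y -> dist x y < e) ->
  exists D : seq (set X), [/\ is_chain D, covers D, (mesh dist D <= e%:E)%E &
    forall x y, f x <= f y -> chain_le D x y].
Proof.
move=> cf fb pq fib; pose h (z : X * X) := `|f z.1 - f z.2|.
have ch : continuous h.
  move=> z; apply: cvg_norm; apply: cvgB.
    by apply: (@cvg_comp _ _ _ fst f); [exact: cvg_fst|exact: cf].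
  by apply: (@cvg_comp _ _ _ snd f); [exact: cvg_snd|exact: cf].
have [d d0 dP] : exists2 d : R, 0 < d & forall x y, h (x, y) < d -> dist x y < e.
  apply: compact_modulus => // x y; rewrite leNgt /h/= normr_gt0 subr_eq0.
  by apply: contraNneq => /fib.
pose l := f q - f p; have l0 : 0 < l by rewrite subr_gt0.
pose N := (Num.truncn (2 * l / d)).+1.
have Nd : 2 * l < d * N%:R.
  by rewrite (mulrC d) -ltr_pdivrMr//; exact: truncnS_gt.
have N0 : 0 < N%:R :> R by rewrite ltr0n.
pose g x := N%:R / l * (f x - f p).
have cg : continuous g.
  move=> x; apply: (@cvgM _ _ _ _ (cst (N%:R / l))); first exact: cvg_cst.
  by apply: cvgB; [exact: cf|exact: cvg_cst].
have gle x y : (g x <= g y) = (f x <= f y).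
  by rewrite /g ler_pM2l ?divr_gt0// lerD2r.
have gp : g p = 0 by rewrite /g subrr mulr0.
have gq : g q = N%:R by rewrite /g -/l mulfVK// gt_eqF.
have gb x : 0 <= g x <= N%:R by rewrite -gq -gp !gle.
exists (level_chain g N); split.
- exact: level_chain_chain gp gq.
- exact: level_chain_covers.
- apply: mesh_le => k x y xk yk; apply/ltW/dP; rewrite /h/=.
  have kN : (k < N.+1)%N by have := mem_link_size xk; rewrite size_mkseq.
  move: xk yk; rewrite level_chainE//= => xk yk.
  have : `|g x - g y| < 2 by move: xk yk; rewrite !ltr_norml; lra.
  rewrite /g -mulrBr opprB addrA subrK normrM gtr0_norm ?divr_gt0//.
  rewrite mulrAC ltr_pdivrMr// => Nl.
  by rewrite -(ltr_pM2l N0); apply: lt_trans Nl _; rewrite (mulrC _ d).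
- by move=> x y xy; apply: level_chain_le => //; rewrite gle.
Qed.

End CompactMetric.

(** * Subspaces as types *)

(** Names the open set of the ambient space that the definition of the topology
    of [S] provides. *)
Lemma open_set_valP {T : topologicalType} (S : set T) (B : set S) :
  open B -> exists2 V : set T, open V & set_val @^-1` V = B.
Proof. by []. Qed.

(** Relatively clopen pieces of the preimage are preimages of relatively clopen
    pieces of [A], and [set_val] maps onto [A] injectively. *)
Lemma set_val_connected {T : topologicalType} (S A : set T) : A `<=` S ->
  connected A -> connected (@set_val _ S @^-1` A).
Proof.
move=> AS connA B [b Bb] [_ /open_set_valP[V oV <-] BV] [C cC BC].
have lift x : A x -> exists2 z : S, (set_val @^-1` A) z & set_val z = x.
  by move=> Ax; exists (exist _ x (mem_set (AS _ Ax))).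
have /open_set_valP[W oW WC] := closed_openC cC.
have CW z : C z <-> ~ W (set_val z).
  have := congr1 (fun Y : set S => Y z) WC; rewrite /= /setC /= => ->.
  by split=> [Cz /(_ Cz)|/contrapT].
have AB : set_val @` B = A.
  apply: connA; first by exists (set_val b), b.
    exists V => //; apply/seteqP; split=> [_ [z + <-]|_ [/lift[z Az <-] Vz]].
      by rewrite BV.
    by exists z => //; rewrite BV.
  exists (~` W); first exact: open_closedC.
  apply/seteqP; split=> [_ [z + <-]|_ [/lift[z Az <-] Wz]].
    by rewrite BC => -[Az /CW].
  by exists z => //; rewrite BC; split => //; exact/CW.
apply/seteqP; split=> z Bz; first by rewrite -AB; exists z.
have : (set_val @` B) (set_val z) by rewrite AB.
by move=> [w Bw /val_inj <-].
Qed.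

Lemma set_val_closed {T : topologicalType} (S A : set T) :
  closed A -> closed (@set_val _ S @^-1` A).
Proof. by apply: closed_comp => z _; exact: (@initial_continuous S T set_val). Qed.

Lemma set_val_compact {T : topologicalType} (S : set T) :
  compact S -> compact [set: S].
Proof.
move=> cS F FF _; have GF : (set_val @ F) S.
  by apply: (@filterE _ F) => z; exact: set_valP.
have [x [Sx xcl]] := cS _ _ GF; exists (exist _ x (mem_set Sx)); split => // A B FA.
rewrite nbhsE => -[_ [/open_set_valP[V oV <-] Vx] VB].
have [||_ [[z Az <-] Vz]] := xcl (set_val @` A) V.
- by apply: (@filterS _ F _ A) FA => z Az; exists z.
- exact: open_nbhs_nbhs.
- by exists z; split => //; exact: VB.
Qed.

(** * Topology of the sine curve *)

Section Warsaw.
Context {R : realType}.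
Implicit Types (a b c : R) (z : R * R).

Definition sine_pt (x : R) : R * R := (x, sin (1 / x)).

(** The part of the curve of abscissa at most [a], written without a closure. *)
Definition warsaw a : set (R * R) :=
  [set z | [/\ 0 <= z.1 <= a, -1 <= z.2 <= 1 & 0 < z.1 -> z.2 = sin (1 / z.1)]].

(** At the abscissa [1 / t] this gives points of the ray at height [c], as close
    to the bar as desired. *)
Lemma sin_eq_large c M : -1 <= c <= 1 -> exists2 t : R, M < t & sin t = c.
Proof.
move=> /asin_def[_ sc]; set s := asin c in sc.
pose n := (Num.truncn (`|M| + `|s|)).+1.
exists (s + n%:R * (pi *+ 2)).
  have nM : `|M| + `|s| < n%:R by exact: truncnS_gt.
  have p1 : (1 : R) <= pi *+ 2 by rewrite mulr2n; have := @pi_ge2 R; lra.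
  have : n%:R <= n%:R * (pi *+ 2) :> R by rewrite ler_peMr.
  have := ler_norm M; have := lerNnormlW (lexx `|s|); lra.
by rewrite mulr_natl (periodicn (@sinD2pi R)).
Qed.

Lemma continuous_sine x : x != 0 -> {for x, continuous (fun x : R => sin (1 / x))}.
Proof.
move=> x0; apply: continuous_comp; last exact: continuous_sin.
by apply: cvgM; [exact: cvg_cst|apply: cvgV => //; exact: cvg_id].
Qed.

Lemma continuous_sine_pt x : x != 0 -> {for x, continuous sine_pt}.
Proof.
move=> x0; apply: (@cvg_pair _ _ _ _ (nbhs x) (nbhs (sin (1 / x))) _ _ _ id).
  exact: cvg_id.
exact: continuous_sine.
Qed.

Lemma box_closed a : closed [set z : R * R | 0 <= z.1 <= a /\ -1 <= z.2 <= 1].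
Proof.
have -> : [set z : R * R | 0 <= z.1 <= a /\ -1 <= z.2 <= 1] =
   fst @^-1` `[0, a]%classic `&` snd @^-1` `[-1, 1]%classic.
  by apply/seteqP; split => z /=; rewrite !in_itv.
apply: closedI; apply: closed_comp; try exact: interval_closed.
  by move=> z _; exact: cvg_fst.
by move=> z _; exact: cvg_snd.
Qed.

(** Limit points with positive abscissa are on the graph by continuity of [sin
    (1 / x)] there. A point [(0, y)] of the bar is a limit because [sin t = y]
    has arbitrarily large solutions [t], giving points [(1 / t, y)] of the
    graph. *)
Lemma closure_sine a : 0 < a -> closure (sine_pt @` [set x | 0 < x <= a]) = warsaw a.
Proof.
move=> a0; apply/seteqP; split=> [z zcl|[x y] [/= /andP[x0 xa] y1 xy]].
  have [z1 z2] : 0 <= z.1 <= a /\ -1 <= z.2 <= 1.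
    apply: (@box_closed a).
    move: z zcl; apply: closure_subset => _ [x /= /andP[x0 xa] <-] /=.
    by rewrite (ltW x0) xa sin_geN1 sin_le1.
  split => // zp; apply/eqP; rewrite -subr_eq0; apply/negPn/negP => nz.
  have ch : {for z, continuous (fun w : R * R => w.2 - sin (1 / w.1))}.
    apply: cvgB; first exact: cvg_snd.
    apply: (@cvg_comp _ _ _ fst (fun x : R => sin (1 / x))); first exact: cvg_fst.
    by apply: continuous_sine; rewrite gt_eqF.
  have /ch : nbhs (z.2 - sin (1 / z.1)) [set v : R | v != 0].
    by apply: open_nbhs_nbhs; split => //; exact: open_neq.
  by move=> /zcl[_ [[x _ <-]]] /=; rewrite subrr eqxx.
have [xp|] := ltP 0 x.
  by apply: subset_closure; exists x; rewrite /= ?xp // /sine_pt -xy.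
move=> xn; have -> : x = 0 by apply/le_anti; rewrite xn.
move=> B /nbhs_ballP[e /= e0 eB].
have [t tM st] := sin_eq_large (Num.max e^-1 a^-1) y1.
move: tM; rewrite gt_max => /andP[te ta].
have t0 : 0 < t by apply: lt_trans te; rewrite invr_gt0.
exists (sine_pt t^-1); split.
  by exists t^-1 => //=; rewrite invr_gt0 t0 invf_ple ?posrE// ltW.
apply: eB; rewrite /sine_pt div1r invrK st; split => /=; last exact: ballxx.
by rewrite /ball/= sub0r normrN gtr0_norm ?invr_gt0// invf_plt ?posrE.
Qed.

Lemma warsaw_closed a : 0 < a -> closed (warsaw a).
Proof. by move=> /closure_sine <-; exact: closed_closure. Qed.

Lemma warsaw_compact a : 0 < a -> compact (warsaw a).
Proof.
move=> a0; have cbox : compact (`[0, a] `*` `[-1, 1] : set (R * R)).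
  by apply: compact_setX; exact: segment_compact.
apply: (subclosed_compact _ cbox); first exact: warsaw_closed.
by move=> z [z1 z2 _]; split; rewrite /= in_itv.
Qed.

Lemma sine_connected (i : interval R) : (forall x, x \in i -> x != 0) ->
  connected (sine_pt @` [set` i]).
Proof.
move=> i0; apply: connected_continuous_connected.
  by apply/connected_intervalP; exact: interval_is_interval.
apply: continuous_in_subspaceT => x /set_mem /= xi.
exact/continuous_sine_pt/i0.
Qed.

(** It is the closure of a continuous image of an interval. *)
Lemma warsaw_connected a : 0 < a -> connected (warsaw a).
Proof.
move=> a0; rewrite -closure_sine//; apply: connected_closure.
have -> : [set x | 0 < x <= a] = [set` `]0, a] ].
  by apply/seteqP; split=> x /=; rewrite in_itv.
by apply: sine_connected => x; rewrite in_itv/= => /andP[/gt_eqF -> _].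
Qed.

Definition bar b c : set (R * R) := [set z | z.1 = 0 /\ b <= z.2 <= c].

Lemma barE b c : bar b c = pair 0 @` `[b, c].
Proof.
apply/seteqP; split=> [[x y] [/= -> yb]|_ [y + <-]].
  by exists y => //=; rewrite in_itv.
by rewrite /= in_itv.
Qed.

Let pair0_continuous : continuous (pair (0 : R) : R -> R * R).
Proof.
move=> y; apply: (@cvg_pair _ _ _ _ (nbhs (0 : R)) (nbhs y) _ _ _ (cst 0) id).
  exact: cvg_cst.
exact: cvg_id.
Qed.

Lemma bar_connected b c : connected (bar b c).
Proof.
rewrite barE; apply: connected_continuous_connected.
  by apply/connected_intervalP; exact: interval_is_interval.
exact: continuous_subspaceT.
Qed.

Lemma bar_closed b c : closed (bar b c).
Proof.
rewrite barE; apply: compact_closed.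
  exact: norm_hausdorff.
apply: continuous_compact; last exact: segment_compact.
exact: continuous_subspaceT.
Qed.

Lemma sine_arc_closed b c : 0 < b -> closed (sine_pt @` `[b, c]).
Proof.
move=> b0; apply: compact_closed.
  exact: norm_hausdorff.
apply: continuous_compact; last exact: segment_compact.
apply: continuous_in_subspaceT => x /set_mem /=; rewrite in_itv/= => /andP[bx _].
by apply: continuous_sine_pt; rewrite gt_eqF// (lt_le_trans b0).
Qed.

End Warsaw.

(** * Coordinates on the sine curve *)

Section SineCurve.
Context {R : realType}.
Implicit Types (z w : S1 R).

Definition tip_x : R := 2 / (3 * pi).

Lemma tip_x_gt0 : 0 < tip_x.
Proof. by rewrite divr_gt0// mulr_gt0// pi_gt0. Qed.

Lemma S1E : S1 R = warsaw tip_x.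
Proof. by rewrite -(closure_sine tip_x_gt0). Qed.

Definition px z : R := (set_val z).1.
Definition py z : R := (set_val z).2.

Lemma px_ge0 z : 0 <= px z.
Proof. by have := set_valP z; rewrite [X in X _]S1E => -[/andP[]]. Qed.

Lemma px_le_tip z : px z <= tip_x.
Proof. by have := set_valP z; rewrite [X in X _]S1E => -[/andP[]]. Qed.

Lemma py_bound z : -1 <= py z <= 1.
Proof. by have := set_valP z; rewrite [X in X _]S1E => -[]. Qed.

Lemma py_sine z : 0 < px z -> py z = sin (1 / px z).
Proof. by have := set_valP z; rewrite [X in X _]S1E => -[_ _ +]; apply. Qed.

Lemma S1_eq z w : px z = px w -> py z = py w -> z = w.
Proof. by move=> xzw yzw; apply: val_inj; exact: injective_projections. Qed.

Lemma px_continuous : continuous px.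
Proof.
move=> z; apply: (@cvg_comp _ _ _ set_val fst _ (nbhs (set_val z))).
  exact: (@initial_continuous (S1 R) _ set_val).
exact: cvg_fst.
Qed.

Lemma py_continuous : continuous py.
Proof.
move=> z; apply: (@cvg_comp _ _ _ set_val snd _ (nbhs (set_val z))).
  exact: (@initial_continuous (S1 R) _ set_val).
exact: cvg_snd.
Qed.

Lemma S1_pt x y : warsaw tip_x (x, y) -> exists2 z, px z = x & py z = y.
Proof. by rewrite -S1E => h; exists (exist _ (x, y) (mem_set h)). Qed.

Lemma bar_point y : -1 <= y <= 1 -> exists2 z, px z = 0 & py z = y.
Proof.
move=> y1; apply: S1_pt; split; rewrite /= ?ltxx//.
by rewrite lexx ltW// tip_x_gt0.
Qed.

Lemma graph_point x : 0 < x <= tip_x -> exists2 z, px z = x & py z = sin (1 / x).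
Proof.
by move=> /andP[x0 xt]; apply: S1_pt; split; rewrite /= ?(ltW x0)// sin_geN1 sin_le1.
Qed.

Lemma S1_compact : compact [set: S1 R].
Proof. by apply: set_val_compact; rewrite S1E; exact: warsaw_compact tip_x_gt0. Qed.

Lemma S1_connected : connected [set: S1 R].
Proof.
have := @set_val_connected _ (S1 R) (S1 R) (fun _ => id).
rewrite [X in connected X -> _]S1E => /(_ (warsaw_connected tip_x_gt0)).
congr connected; apply/seteqP; split => // z _; exact: set_valP.
Qed.

End SineCurve.

(** * Folding maps *)

Section Fold.
Context {R : realType}.
Variables (s a : R).
Hypotheses (a0 : 0 < a) (a_tip : a <= tip_x) (sa : sin (1 / a) = s) (ss : s * s = 1).

(** With [s = sin (1 / a) = 1] or [-1], this is [s * py z] left of the abscissa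
    [a] and [1 + (px z - a)] right of it; this single formula makes continuity
    immediate. *)
Definition fold (z : S1 R) : R :=
  s * (py z - sin (1 / Num.max (px z) a)) + 1 + (Num.max (px z) a - a).

Lemma fold_continuous : continuous fold.
Proof.
have cm : continuous (fun z : S1 R => Num.max (px z) a).
  move=> z; apply: (@continuous_max _ _ px (cst a)).
    exact: px_continuous.
  exact: cst_continuous.
move=> z; have c0 : {for Num.max (px z) a, continuous (fun x : R => sin (1 / x))}.
  by apply: continuous_sine; rewrite gt_eqF// lt_max a0 orbT.
have cs := continuous_comp (cm z) c0.
exact: (cvgD (cvgD (cvgM (cvg_cst s) (cvgB (@py_continuous R z) cs)) (cvg_cst (1 : R)))
             (cvgB (cm z) (cvg_cst a))).
Qed.

Lemma fold_left z : px z <= a -> fold z = s * py z.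
Proof. by move=> za; rewrite /fold (max_idPr za) sa mulrBr ss; lra. Qed.

Lemma fold_right z : a <= px z -> fold z = 1 + (px z - a).
Proof.
move=> za; rewrite /fold (max_idPl za) -py_sine ?(lt_le_trans a0)//.
by rewrite subrr mulr0 add0r.
Qed.

Lemma s_eq1_or_eqN1 : s = 1 \/ s = -1.
Proof.
have : (s == 1) || (s == -1) by rewrite -sqrf_eq1 expr2 ss.
by case/orP => /eqP; [left|right].
Qed.

Lemma fold_bound z : -1 <= fold z <= 1 + (tip_x - a).
Proof.
have [za|/ltW za] := leP (px z) a; last first.
  by rewrite fold_right// lerD2l lerD2r px_le_tip; move: za; lra.
rewrite fold_left//; have := py_bound z; have := a_tip.
by have [->|->] := s_eq1_or_eqN1; lra.
Qed.

(** Left of the cut [fold] takes values at most [1], right of it larger than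
    [1], and there it determines the abscissa. *)
Lemma fold_fiber z w : fold z = fold w ->
  px z <= a /\ px w <= a /\ py z = py w \/ z = w.
Proof.
wlog : z w / px z <= px w.
  move=> H; case: (leP (px z) (px w)) => [|/ltW] zw; first exact: H.
  by move=> /esym/(H _ _ zw)[[wa [za yy]]|->]; [left|right].
move=> zw fzw; have [wa|aw] := leP (px w) a.
  left; have za := le_trans zw wa; split => //; split => //.
  by move: fzw; rewrite !fold_left//; have [->|->] := s_eq1_or_eqN1; lra.
right; move: fzw; rewrite (@fold_right w) ?(ltW aw)//.
have [za|az] := leP (px z) a.
  rewrite (@fold_left z)// => h; exfalso; have := py_bound z.
  by move: h aw; have [->|->] := s_eq1_or_eqN1; lra.
rewrite (@fold_right z) ?(ltW az)// => h.
have pzw : px z = px w by lra.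
by apply: S1_eq => //; rewrite !py_sine ?pzw// (lt_trans a0).
Qed.

End Fold.

(** * The four orders *)

Section Orders.
Context {R : realType}.
Implicit Types (o u : bool) (x y z : S1 R).

(** [o] tells whether the bar precedes the ray, and [u] whether the bar is
    traversed upwards. *)
Definition warsaw_le o u x y : Prop :=
  if px x == px y then (py x == py y) || ((py x < py y) == u)
  else (px x < px y) == o.

(** Comparing these three points reveals both choices made by an order. *)
Definition is_corners (x0 x1 xt : S1 R) : Prop :=
  [/\ px x0 = 0 /\ py x0 = -1, px x1 = 0 /\ py x1 = 1 & px xt = tip_x].

Lemma corners_exist : exists x0 x1 xt, is_corners x0 x1 xt.
Proof.
have [|x0 ? ?] := @bar_point R (-1); first by rewrite lexx; lra.
have [|x1 ? ?] := @bar_point R 1; first by rewrite lexx; lra.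
have [|xt ? _] := @graph_point R tip_x; first by rewrite lexx tip_x_gt0.
by exists x0, x1, xt.
Qed.

Lemma warsaw_le_tip o u x0 x1 xt : is_corners x0 x1 xt -> warsaw_le o u x0 xt = o.
Proof.
by move=> [[p0 _] _ pt]; rewrite /warsaw_le p0 pt lt_eqF ?tip_x_gt0.
Qed.

Lemma warsaw_le_bar o u x0 x1 xt : is_corners x0 x1 xt -> warsaw_le o u x0 x1 = u.
Proof.
move=> [[p0 q0] [p1 q1] _]; rewrite /warsaw_le p0 p1 eqxx q0 q1.
have -> : (-1 == 1 :> R) = false by apply/negbTE/eqP; lra.
have -> : -1 < 1 :> R by lra.
by case: u => //=; rewrite propeqE.
Qed.

Lemma bar_sub_S1 b c : -1 <= b -> c <= 1 -> bar b c `<=` S1 R.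
Proof.
move=> b1 c1 [x y] [/= -> /andP[bz zc]]; rewrite S1E; split; rewrite /= ?ltxx//.
  by rewrite lexx ltW// tip_x_gt0.
by rewrite (le_trans b1)// (le_trans zc).
Qed.

(** For [px x = 0] the part is the bar itself, a case that [closure_sine] does
    not cover. *)
Lemma left_part x : exists A : set (R * R),
  [/\ closed A, connected A, A `<=` S1 R & forall z, A (set_val z) <-> px z <= px x].
Proof.
have [p0|pn] := eqVneq (px x) 0.
  exists (bar (-1) 1); split;
    [exact: bar_closed|exact: bar_connected|exact: bar_sub_S1|].
  move=> z; rewrite p0; split=> [[z0 _]|z0]; first by rewrite /px z0.
  by split; [apply/le_anti; rewrite z0; exact: px_ge0|exact: py_bound].
have pp : 0 < px x by rewrite lt_neqAle eq_sym pn px_ge0.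
exists (warsaw (px x)); split; [exact: warsaw_closed|exact: warsaw_connected| |].
  move=> z [/andP[z0 zx] z1 z2]; rewrite S1E; split => //.
  by rewrite z0 (le_trans zx)// px_le_tip.
move=> z; split=> [[/andP[]]//|zx].
by split; [rewrite px_ge0|exact: py_bound|exact: py_sine].
Qed.

Lemma right_part x : 0 < px x -> exists A : set (R * R),
  [/\ closed A, connected A, A `<=` S1 R & forall z, A (set_val z) <-> px x <= px z].
Proof.
move=> x0; exists (sine_pt @` `[px x, tip_x]); split.
- exact: sine_arc_closed.
- apply: sine_connected => z; rewrite in_itv/= => /andP[xz _].
  by rewrite gt_eqF// (lt_le_trans x0).
- move=> _ [z + <-]; rewrite S1E /= in_itv/= => /andP[xz zt].
  by split; rewrite /= ?sin_geN1 ?sin_le1// zt (ltW (lt_le_trans x0 xz)).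
move=> z; split=> [[y + yz]|xz].
  by rewrite /= in_itv/= /px -yz => /andP[].
exists (px z); first by rewrite /= in_itv/= xz px_le_tip.
by apply: injective_projections => //=; rewrite -py_sine// (lt_le_trans x0).
Qed.

Section Classification.
Variable r : S1 R -> S1 R -> Prop.
Hypothesis r_total : forall x y, r x y \/ r y x.
Hypothesis r_antisym : forall x y, r x y -> r y x -> x = y.
Hypothesis r_side : forall (C : set (S1 R)) p c c', closed C -> connected C ->
  ~ C p -> C c -> C c' -> r c p -> r c' p.

Lemma r_flip x y : x <> y -> r y x <-> ~ r x y.
Proof.
move=> xy; split=> [yx /r_antisym/(_ yx)//|nxy].
by have [] := r_total x y.
Qed.

Lemma r_side_val (A : set (R * R)) p c c' : closed A -> connected A ->
  A `<=` S1 R -> ~ A (set_val p) -> A (set_val c) -> A (set_val c') ->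
  (r c p <-> r c' p) /\ (r p c <-> r p c').
Proof.
move=> clA connA AS nAp Ac Ac'.
have H a b : A (set_val a) -> A (set_val b) -> r a p -> r b p.
  move=> Aa Ab; apply: (@r_side (set_val @^-1` A)) => //.
    exact: set_val_closed.
  exact: set_val_connected.
have np a : A (set_val a) -> a <> p by move=> + ap; rewrite ap.
have cc' : r c p <-> r c' p by split; exact: H.
by split => //; rewrite (r_flip (np _ Ac)) (r_flip (np _ Ac')) cc'.
Qed.

Variables (x0 x1 xt : S1 R).
Hypothesis corners : is_corners x0 x1 xt.

(** First slide [x] to the bar inside the part of the curve left of [x], which
    misses [y]; then slide [y] to the end of the ray inside the arc right of
    [y], which misses the bar. *)
Lemma r_abscissa x y : px x < px y -> r x y <-> r x0 xt.
Proof.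
have [[p0 q0] [p1 q1] pt] := corners.
move=> xy; have y0 : 0 < px y by apply: le_lt_trans xy; exact: px_ge0.
have [A [clA cA AS AP]] := left_part x.
have [|||-> _] := @r_side_val A y x x0 clA cA AS; rewrite ?AP ?p0 ?px_ge0//.
  by rewrite leNgt xy.
have [B [clB cB BS BP]] := right_part y0.
have [|||_ ->] := @r_side_val B x0 y xt clB cB BS; rewrite ?BP ?p0 ?pt ?px_le_tip//.
by rewrite leNgt y0.
Qed.

(** Slide [x] down to the bottom of the bar, then [y] up to its top. *)
Lemma r_bar x y : px x = 0 -> px y = 0 -> py x < py y -> r x y <-> r x0 x1.
Proof.
have [[p0 q0] [p1 q1] pt] := corners.
move=> px0 py0 xy; have /andP[x_1 x_2] := py_bound x.
have /andP[y_1 y_2] := py_bound y.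
have barP b c z : px z = 0 -> bar b c (set_val z) <-> b <= py z <= c.
  by move=> z0; split=> [[]|].
have [||||||-> _] := @r_side_val (bar (-1) (py x)) y x x0.
- exact: bar_closed.
- exact: bar_connected.
- exact: bar_sub_S1.
- by rewrite barP// (leNgt _ (py x)) xy andbF.
- by rewrite barP// x_1 lexx.
- by rewrite barP// q0 lexx.
have [||||||_ ->] := @r_side_val (bar (py y) 1) x0 y x1.
- exact: bar_closed.
- exact: bar_connected.
- exact: bar_sub_S1.
- by rewrite barP// q0 (leNgt (py y)) (le_lt_trans x_1 xy).
- by rewrite barP// lexx.
- by rewrite barP// q1 lexx y_2.
by [].
Qed.

Lemma warsaw_le_classification : r = warsaw_le `[<r x0 xt>] `[<r x0 x1>].
Proof.
apply/funext => x; apply/funext => y; apply/propext; rewrite /warsaw_le.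
have refl z : r z z by have [] := r_total z z.
have [pxy|pxy] := eqVneq (px x) (px y); last first.
  move: pxy; rewrite neq_lt => /orP[xy|yx].
    by rewrite (r_abscissa xy) xy eq_sym eqb_id; split=> /asboolP.
  have /r_flip -> : y <> x by move=> e; move: yx; rewrite e ltxx.
  rewrite (r_abscissa yx) ltNge (ltW yx) /= eq_sym eqbF_neg.
  by split=> [/asboolPn|/asboolPn].
have [qxy|qxy] := eqVneq (py x) (py y).
  by rewrite (S1_eq pxy qxy); split => // _; exact: refl.
have px0 : px x = 0.
  apply/eqP; apply: contraNT qxy => x0n.
  have xp : 0 < px x by rewrite lt_neqAle eq_sym x0n px_ge0.
  by rewrite !py_sine -?pxy.
move: qxy => /=; rewrite neq_lt => /orP[xy|yx].
  by rewrite (r_bar px0 _ xy) -?pxy// xy eq_sym eqb_id; split=> /asboolP.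
have /r_flip -> : y <> x by move=> e; move: yx; rewrite e ltxx.
rewrite (r_bar _ px0 yx) -?pxy// ltNge (ltW yx) /= eq_sym eqbF_neg.
by split=> [/asboolPn|/asboolPn].
Qed.

End Classification.

Variable dist : S1 R -> S1 R -> R.
Hypothesis dc : compatible_metric dist.

Lemma ultrafilter_le_warsaw (D : nat -> seq (set (S1 R))) (U : set_system nat)
    x0 x1 xt :
  is_corners x0 x1 xt -> (forall n, is_chain (D n) /\ covers (D n)) ->
  mesh dist (D n) @[n --> \oo] --> 0%E -> nonprincipal_ultrafilter U ->
  ultrafilter_le D U =
    warsaw_le `[<ultrafilter_le D U x0 xt>] `[<ultrafilter_le D U x0 x1>].
Proof.
move=> co Dch Dm Unp; apply: (warsaw_le_classification _ _ _ co).
- exact: ultrafilter_le_total.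
- exact: (ultrafilter_le_antisym dc).
- by move=> C p c c'; exact: (ultrafilter_le_side dc Dch Dm Unp).
Qed.

(** Points close to the bar at the same height are close: apply
    [compact_modulus] to the sum of the abscissas and the difference of heights,
    which vanishes only at a pair of equal points. Cutting left of half the
    resulting [d] makes all fibres of the fold short. *)
Lemma thin_fold (s e : R) : 0 < e -> s * s = 1 ->
  exists a, [/\ 0 < a <= tip_x, sin (1 / a) = s &
    forall z w, fold s a z = fold s a w -> dist z w < e].
Proof.
move=> e0 ss; have [[d0 dE _ _] _] := dc.
pose h (p : S1 R * S1 R) := px p.1 + px p.2 + `|py p.1 - py p.2|.
have ch : continuous h.
  move=> p.
  have c (f : S1 R -> R) : continuous f ->
      (f q.1 @[q --> p] --> f p.1) /\ (f q.2 @[q --> p] --> f p.2).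
    move=> cf; split.
      by apply: (@cvg_comp _ _ _ fst f); [exact: cvg_fst|exact: cf].
    by apply: (@cvg_comp _ _ _ snd f); [exact: cvg_snd|exact: cf].
  have [x1 x2] := c _ (@px_continuous R); have [y1 y2] := c _ (@py_continuous R).
  exact: (cvgD (cvgD x1 x2) (cvg_norm (cvgB y1 y2))).
have [d dp dP] : exists2 d : R, 0 < d & forall x y, h (x, y) < d -> dist x y < e.
  apply: (compact_modulus dc S1_compact) => // x y exy; rewrite ltNge; apply/negP.
  rewrite /h /= => hle; have := px_ge0 x; have := px_ge0 y.
  have := normr_ge0 (py x - py y) => n0 y0 x0.
  have xy : x = y.
    apply: S1_eq; first by lra.
    by apply/eqP; rewrite -subr_eq0 -normr_eq0; apply/eqP; lra.
  by have /dE dxy := xy; move: exy; rewrite dxy leNgt e0.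
have s1 : -1 <= s <= 1.
  by have [->|->] := s_eq1_or_eqN1 ss; rewrite lexx ?andbT/=; lra.
have [t tM st] := sin_eq_large (Num.max tip_x^-1 (d / 2)^-1) s1.
move: tM; rewrite gt_max => /andP[tt td].
have t0 : 0 < t by apply: lt_trans tt; rewrite invr_gt0 tip_x_gt0.
have a0 : 0 < t^-1 by rewrite invr_gt0.
have atip : t^-1 <= tip_x by rewrite invf_ple ?posrE ?tip_x_gt0// ltW.
have ad : t^-1 < d / 2 by rewrite invf_plt ?posrE// divr_gt0.
have sa : sin (1 / t^-1) = s by rewrite div1r invrK.
exists t^-1; split => //; first by rewrite a0.
move=> z w /(fold_fiber a0 sa ss)[[za [wa zw]]|->].
  by apply: dP; rewrite /h /= zw subrr normr0 addr0; lra.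
by have /dE -> : w = w by [].
Qed.

Lemma warsaw_chain o u (e : R) : 0 < e ->
  exists D : seq (set (S1 R)), [/\ is_chain D, covers D, (mesh dist D <= e%:E)%E &
    forall x0 x1 xt, is_corners x0 x1 xt ->
      (if o then chain_le D x0 xt else chain_le D xt x0) /\
      (if u then chain_le D x0 x1 else chain_le D x1 x0)].
Proof.
(* With [s = 1] the map goes up the bar and then along the ray; taking its
   opposite flips both choices, so [s] compares [o] with [u]. *)
move=> e0; have [s ss sE] : exists2 s : R, s * s = 1 & s = if o == u then 1 else -1.
  by exists (if o == u then 1 else -1) => //; case: ifP; rewrite ?mulrNN mulr1.
have [a [/andP[a0 atip] sa fib]] := thin_fold e0 ss.
have [y0 [y1 [yt co]]] := corners_exist.
have fco z0 z1 zt : is_corners z0 z1 zt ->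
    [/\ fold s a z0 = - s, fold s a z1 = s & fold s a zt = 1 + (tip_x - a)].
  move=> [[p0 q0] [p1 q1] pt].
  rewrite (@fold_left _ s a _ _ z0) ?p0 ?ltW// (@fold_left _ s a _ _ z1) ?p1 ?ltW//.
  by rewrite fold_right ?pt// q0 q1 mulrN mulr1.
have := fold_bound a0 atip sa ss => fb.
have cf : continuous (fold s a) by exact: fold_continuous.
have [yb fyb] : exists yb, fold s a yb = -1.
  have [f0 f1 _] := fco _ _ _ co.
  by have [s1|s1] := s_eq1_or_eqN1 ss; [exists y0; rewrite f0 s1|exists y1; rewrite f1].
have [_ _ fyt] := fco _ _ _ co.
have bt : fold s a yb < fold s a yt by rewrite fyb fyt; lra.
have leco x0 x1 xt : is_corners x0 x1 xt -> fold s a x0 <= fold s a xt.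
  by move=> /fco[_ _ ->]; have /andP[] := fb x0.
case: o sE => sE.
  have [|D [chD covD mD leD]] :=
      small_fibers_chain dc S1_compact S1_connected cf _ bt fib.
    by move=> x; rewrite fyb fyt.
  exists D; split => // x0 x1 xt cx; split; first exact: leD (leco _ _ _ cx).
  have [f0 f1 _] := fco _ _ _ cx.
  by case: u sE => /= sE; apply: leD; rewrite f0 f1 sE; lra.
have cNf : continuous (- fold s a) by move=> x; exact: cvgN (cf x).
have bNt : (- fold s a) yt < (- fold s a) yb by rewrite ltrN2.
have [||D [chD covD mD leD]] :=
    small_fibers_chain dc (e := e) S1_compact S1_connected cNf _ bNt.
- by move=> x; rewrite !lerN2 fyb fyt andbC.
- by move=> x y /oppr_inj/fib.
exists D; split => // x0 x1 xt cx; split.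
  by apply: leD; rewrite lerN2; exact: (leco _ _ _ cx).
have [f0 f1 _] := fco _ _ _ cx.
by case: u sE => /= sE; apply: leD; rewrite lerN2 f0 f1 sE; lra.
Qed.

(** By the classification only the two comparisons of corner points matter, and
    the chains of [warsaw_chain] all decide them in the prescribed way. *)
Lemma warsaw_le_ultrafilter_order o u : ultrafilter_orders dist (warsaw_le o u).
Proof.
have Dex n : exists D : seq (set (S1 R)),
    [/\ is_chain D, covers D, (mesh dist D <= (n.+1%:R^-1)%:E)%E &
      forall x0 x1 xt, is_corners x0 x1 xt ->
        (if o then chain_le D x0 xt else chain_le D xt x0) /\
        (if u then chain_le D x0 x1 else chain_le D x1 x0)].
  by apply: warsaw_chain; rewrite invr_gt0.
pose D n := projT1 (cid (Dex n)).
have DP n := projT2 (cid (Dex n)); rewrite -/(D _) in DP.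
have [U [UU oU]] := @ultraFilterLemma nat \oo _.
have Unp : nonprincipal_ultrafilter U.
  split => // n Un; have : U (~` [set n]).
    by apply: oU; exists n.+1 => // m /= nm; apply/eqP; rewrite gtn_eqF.
  by rewrite Un /principal_filter/= => /(_ n erefl); exact.
have Dch n : is_chain (D n) /\ covers (D n) by have [] := DP n.
have [x0 [x1 [xt co]]] := corners_exist.
have [[d0 dE _ _] _] := dc.
have Dm : mesh dist (D n) @[n --> \oo] --> 0%E.
  apply: (@squeeze_cvge _ _ _ _ (cst 0%E) _ (fun n => (n.+1%:R^-1)%:E)).
  - apply: nearW => n; have [_ cov mD _] := DP n; rewrite mD andbT.
    have [i _ ix] := cov x0; rewrite leNgt; apply/negP => m0.
    by have := dist_lt_mesh m0 ix ix; rewrite ltNge d0.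
  - exact: cvg_cst.
  - by apply: cvg_EFin; [exact: nearW|exact: cvg_harmonic].
exists D, U; split => //.
have rE := ultrafilter_le_warsaw co Dch Dm Unp.
have UP : ProperFilter U by exact: ultra_proper.
have total := ultrafilter_le_total Dch Unp.
have anti := ultrafilter_le_antisym dc Dch Dm Unp.
have dec (b : bool) x y : x <> y ->
    (forall n, if b then chain_le (D n) x y else chain_le (D n) y x) ->
    `[<ultrafilter_le D U x y>] = b.
  move=> xy; case: b => h; first by apply/asboolP/filterE.
  by apply/asboolPn => /anti h1; apply: xy; apply: h1; exact: filterE.
rewrite rE; congr warsaw_le; apply/esym/dec.
- by move=> e; have [[p0 _] _ pt] := co; have := @tip_x_gt0 R; rewrite -pt -e p0 ltxx.
- by move=> n; have [_ _ _ /(_ _ _ _ co)[]] := DP n.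
- by move=> e; have [[_ q0] [_ q1] _] := co; move: q1; rewrite -e q0; lra.
- by move=> n; have [_ _ _ /(_ _ _ _ co)[]] := DP n.
Qed.

End Orders.

Theorem theorem4p6 (R : realType) (dist : S1 R -> S1 R -> R)
    (dist_compat : compatible_metric dist) :
  [/\ continuum R (S1 R), chainable dist & (ultrafilter_orders dist #= `I_4)%card].
Proof.
have [x0 [x1 [xt co]]] := @corners_exist R.
split.
- by split; [exact: S1_compact|exact: S1_connected|exists dist].
- move=> e e0.
  have [|D [chD covD mD _]] := warsaw_chain dist_compat true true (e := e / 2).
    by rewrite divr_gt0.
  exists D; split => //; apply: le_lt_trans mD _.
  by rewrite lte_fin; lra.
have -> : ultrafilter_orders dist =
    (fun p : bool * bool => @warsaw_le R p.1 p.2) @` [set: bool * bool].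
  apply/seteqP; split=> [_ [D [U [Dch Dm Unp ->]]]|_ [[b c] _ <-]].
    by rewrite (ultrafilter_le_warsaw dist_compat co Dch Dm Unp); eexists (_, _).
  exact: warsaw_le_ultrafilter_order.
have inj : {in [set: bool * bool] &,
    injective (fun p : bool * bool => @warsaw_le R p.1 p.2)}.
  move=> [b c] [b' c'] _ _ /= E.
  have := congr1 (fun r => r x0 xt) E; have := congr1 (fun r => r x0 x1) E.
  rewrite !(warsaw_le_tip _ _ co) !(warsaw_le_bar _ _ co) => cc' bb'.
  have eqb (e e' : bool) : e = e' :> Prop -> e = e'.
    by move=> ee'; apply/idP/idP; rewrite ee'.
  by rewrite (eqb _ _ bb') (eqb _ _ cc').
apply: card_eq_trans (inj_card_eq inj) _.
(* Binary numeration identifies the pairs of choices with [0, 1, 2, 3]. *)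
pose code (p : bool * bool) : nat := (p.1 + 2 * p.2)%N.
have code_inj : {in [set: bool * bool] &, injective code}.
  by move=> [[] []] [[] []].
have -> : `I_4 = code @` [set: bool * bool].
  apply/seteqP; split=> [[|[|[|[|k]]]] //= _|_ [[[] []] _ <-] //].
  - by exists (false, false).
  - by exists (true, false).
  - by exists (false, true).
  - by exists (true, true).
by rewrite card_eq_sym; exact: inj_card_eq.
Qed.
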